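(* When the followers stochastically reach a Nash equilibrium drawn from a probability distribution over all Nash equilibria, solving the Stackelberg game under the assumption of optimistic equilibrium, or under the assumption of pessimistic equilibrium, can give the leader an expected payoff arbitrarily worse than the optimal one. That is: (a) for every $M>0$ there exist a Stackelberg game with one leader and multiple followers (without leader constraints) and a stochastic equilibrium oracle $\mathcal O$ for it such that an optimistic-optimal leader strategy exists and every optimistic-optimal leader strategy $\pi_{\mathrm{opt}}$ satisfies $$\mathbb E_{\boldsymbol x\sim\mathcal O(\pi_{\mathrm{opt}})}f(\boldsymbol x,\pi_{\mathrm{opt}})\le \sup_{\pi\in\Pi}\mathbb E_{\boldsymbol x\sim\mathcal O(\pi)}f(\boldsymbol x,\pi)-M;$$ (b) for every $M>0$ there exist a Stackelberg game with one leader and multiple followers (without leader constraints) and a stochastic equilibrium oracle $\mathcal O$ for it such that a pessimistic-optimal leader strategy exists and every pessimistic-optimal leader strategy $\pi_{\mathrm{pes}}$ satisfies $$\mathbb E_{\boldsymbol x\sim\mathcal O(\pi_{\mathrm{pes}})}f(\boldsymbol x,\pi_{\mathrm{pes}})\le \sup_{\pi\in\Pi}\mathbb E_{\boldsymbol x\sim\mathcal O(\pi)}f(\boldsymbol x,\pi)-M.$$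
   Context: A Stackelberg game with one leader and $n\geq 2$ followers consists of a leader strategy set $\Pi$ (possibly finite), follower strategy sets $\mathcal X_i$ given by linear constraints (for instance, the simplex of mixed strategies over finitely many pure strategies), follower objectives $f_i(x_i,x_{-i},\pi)$, each minimized by follower $i$ (equivalently, payoffs $-f_i$ are maximized), and a leader payoff $f(\boldsymbol x,\pi)$, maximized by the leader. The leader announces $\pi\in\Pi$; the followers then play a simultaneous game. A Nash equilibrium at $\pi$ is $\boldsymbol x=(x_1,\dots,x_n)\in\prod_i\mathcal X_i$ such that $f_i(x_i,x_{-i},\pi)\le f_i(x_i',x_{-i},\pi)$ for all $i$ and all $x_i'\in\mathcal X_i$. Write $\mathrm{NE}(\pi)$ for the set of Nash equilibria at $\pi$ (assumed nonempty). A stochastic equilibrium oracle $\mathcal O$ assigns to each $\pi\in\Pi$ a probability distribution $\mathcal O(\pi)$ on $\mathrm{NE}(\pi)$; the leader's expected payoff from $\pi$ is $\mathbb E_{\boldsymbol x\sim\mathcal O(\pi)}f(\boldsymbol x,\pi)$, and the optimal payoff is the supremum of this over $\pi\in\Pi$. A leader strategy is optimistic-optimal if it maximizes $\pi\mapsto\sup_{\boldsymbol x\in\mathrm{NE}(\pi)}f(\boldsymbol x,\pi)$ over $\Pi$ (the leader assumes followers select the equilibrium best for her), and pessimistic-optimal if it maximizes $\pi\mapsto\inf_{\boldsymbol x\in\mathrm{NE}(\pi)}f(\boldsymbol x,\pi)$ over $\Pi$. *)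

(* Defs.v *)
From HB Require Import structures.
From mathcomp Require Import all_boot all_order all_algebra.
From mathcomp Require Import all_classical all_reals all_analysis.
Set Implicit Arguments.
Unset Strict Implicit.
Unset Printing Implicit Defensive.
Import Order.TTheory GRing.Theory Num.Theory.
Import numFieldNormedType.Exports.
Local Open Scope classical_set_scope.
Local Open Scope ring_scope.

(* Follower i's strategy set is the polyhedron
     {x : 'cV_(dim i) | lhs i *m x <= rhs i entrywise};
   equality constraints, such as those of a simplex, are pairs of opposite
   inequalities. The leader's strategies are all the elements of leader, and
   no further (e.g. equilibrium-dependent) constraint is imposed on her.
   The functions cost i and payoff are total on profiles, but only their values
   on feasible profiles matter for Nash equilibria. *)
Record stackelberg_data (R : realType) := StackelbergData {
  leader : Type;
  followers : nat;
  followers_ge2 : (2 <= followers)%N;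
  dim : 'I_followers -> nat;
  nconstr : 'I_followers -> nat;
  lhs : forall i, 'M[R]_(nconstr i, dim i);
  rhs : forall i, 'cV[R]_(nconstr i);
  cost : 'I_followers -> (forall i, 'cV[R]_(dim i)) -> leader -> R;
  payoff : (forall i, 'cV[R]_(dim i)) -> leader -> R
}.

Section Equilibria.
Variables (R : realType) (G : stackelberg_data R).

Definition profile := prod_topology (fun i : 'I_(followers G) => 'cV[R]_(dim i)).

Definition strategy_set (i : 'I_(followers G)) : set 'cV[R]_(dim i) :=
  [set x | forall k, (lhs i *m x) k 0 <= rhs i k 0].

(* dfwith x i y is the profile x with its i-th component replaced by y. *)
Definition NE (pi : leader G) : set profile :=
  [set x | (forall i, strategy_set (x i)) /\
           forall i (y : 'cV[R]_(dim i)), strategy_set y ->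
             cost i x pi <= cost i (dfwith x i y) pi].

End Equilibria.

Record stackelberg_game (R : realType) := StackelbergGame {
  game_data :> stackelberg_data R;
  NE_nonempty : forall pi : leader game_data, NE pi !=set0
}.

(* The space of profiles with its Borel sigma-algebra. *)
Definition borel_profile (R : realType) (G : stackelberg_data R) :=
  g_sigma_algebraType (@open (profile G)).

(* Integrability of the leader's payoff is what makes her expected payoff a
   well-defined real number. *)
Record stochastic_oracle (R : realType) (G : stackelberg_game R) :=
  StochasticOracle {
  draw :> leader G -> probability (borel_profile G) R;
  draw_NE : forall pi, {ae draw pi, forall x, NE pi x};
  draw_integrable : forall pi,
    (draw pi).-integrable setT (EFin \o (@payoff R G)^~ pi)
}.

Section LeaderPayoffs.
Variables (R : realType) (G : stackelberg_game R).
Local Open Scope ereal_scope.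

Definition expected_payoff (O : stochastic_oracle G) (pi : leader G) : \bar R :=
  'E_(O pi)[(@payoff R G)^~ pi].

Definition optimal_payoff (O : stochastic_oracle G) : \bar R :=
  ereal_sup (range (expected_payoff O)).

Definition optimistic_value (pi : leader G) : \bar R :=
  ereal_sup [set (payoff x pi)%:E | x in NE pi].

Definition pessimistic_value (pi : leader G) : \bar R :=
  ereal_inf [set (payoff x pi)%:E | x in NE pi].

Definition optimistic_optimal (pi : leader G) : Prop :=
  forall pi' : leader G, optimistic_value pi' <= optimistic_value pi.

Definition pessimistic_optimal (pi : leader G) : Prop :=
  forall pi' : leader G, pessimistic_value pi' <= pessimistic_value pi.

End LeaderPayoffs.

(* Main.v *)
(** The followers play a coordination game on [0, 1], whose equilibria include
    the profiles (0, 0) and (1, 1), and the leader chooses between a safe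
    strategy, which always pays 0, and a risky one, which pays [a] at (0, 0)
    and [b] at (1, 1). The oracle always selects (1, 1).
    For a = 1, b = -M the optimistic leader takes the risk, hoping for 1, and
    gets -M instead of 0. For a = -1, b = M the pessimistic leader plays safe,
    fearing -1, and gets 0 instead of M. *)
Require Import Defs.
From HB Require Import structures.
From mathcomp Require Import all_boot all_order all_algebra.
From mathcomp Require Import all_classical all_reals all_analysis measurable_realfun.
Import Order.TTheory GRing.Theory Num.Theory.
Import numFieldNormedType.Exports.
Local Open Scope classical_set_scope.
Local Open Scope ring_scope.

(** The rays []x, +oo[] generate the Borel sets of [R], and their preimages under [f] are open,
    hence among the generators of the sigma-algebra of [borel_profile]. *)
Lemma continuous_borel_profile_measurable (R : realType)
    (G : stackelberg_data R) (f : profile G -> R) :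
  continuous f -> measurable_fun [set: borel_profile G] f.
Proof.
move=> cf; apply: (measurability _ (RGenOInfty.measurableE R)).
move=> _ [_ [x ->] <-]; rewrite setTI; apply: sub_sigma_algebra.
by apply: open_comp => [y _|]; [exact: cf|exact: interval_open].
Qed.

(** A product of Hausdorff spaces is Hausdorff, so points are closed. *)
Lemma borel_profile_measurable_set1 (R : realType) (G : stackelberg_data R)
    (x : borel_profile G) :
  measurable [set x].
Proof.
rewrite -[X in measurable X]setCK; apply: measurableC.
apply: sub_sigma_algebra; apply: closed_openC.
apply/accessible_closed_set1/hausdorff_accessible/hausdorff_product => i.
exact: norm_hausdorff.
Qed.

Section DiracOracle.
Context {R : realType} (G : stackelberg_game R).
Variable eq_at : leader G -> borel_profile G.
Hypothesis eq_at_NE : forall pi, NE pi (eq_at pi).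
Hypothesis payoff_continuous :
  forall pi, continuous ((@payoff R G)^~ pi : profile G -> R).

Let point_mass (pi : leader G) : probability (borel_profile G) R :=
  dirac (eq_at pi).

Let measurable_payoff pi : measurable_fun [set: borel_profile G]
  (EFin \o ((@payoff R G)^~ pi : borel_profile G -> R)).
Proof.
apply/measurable_EFinP.
exact: (continuous_borel_profile_measurable _ _ _ (payoff_continuous pi)).
Qed.

Let dirac_NE pi : {ae point_mass pi, forall x, NE pi x}.
Proof.
(* The complement of the chosen equilibrium is a measurable null set that contains every
   non-equilibrium; measurability of [NE pi] itself never comes up. *)
exists (~` [set eq_at pi]); split.
- by apply: measurableC; exact: borel_profile_measurable_set1.
- by rewrite /= diracE memNset//; apply; reflexivity.
- by apply: subsetC => _ ->; exact: eq_at_NE.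
Qed.

Let dirac_integrable pi :
  (point_mass pi).-integrable setT (EFin \o (@payoff R G)^~ pi).
Proof.
apply/integrableP; split; first exact: measurable_payoff.
(* Against a point mass, the integral of the absolute payoff is a single real value, hence
   finite. *)
rewrite integral_dirac//; last first.
  by apply: measurableT_comp => //; exact: measurable_payoff.
by rewrite diracT mul1e/= ltry.
Qed.

Definition dirac_oracle : stochastic_oracle G :=
  @StochasticOracle R G point_mass dirac_NE dirac_integrable.

Lemma expected_payoff_dirac pi :
  expected_payoff dirac_oracle pi = (payoff (eq_at pi) pi)%:E.
Proof.
rewrite /expected_payoff unlock integral_dirac//; last exact: measurable_payoff.
by rewrite diracT mul1e.
Qed.

End DiracOracle.

Section CoordinationGame.
Context {R : realType} (a b : R).

(* The leader's strategy [true] is the risky one. The two rows of [lhs] and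
   [rhs] say x <= 1 and - x <= 0. *)
Definition coordination_data : stackelberg_data R :=
  @StackelbergData R bool 2 isT (fun=> 1) (fun=> 2)
    (fun=> \col_(k < 2) (-1) ^+ k)
    (fun=> \col_(k < 2) (k == ord0)%:R)
    (fun _ x _ => (x ord0 0 0 - x ord_max 0 0) ^+ 2)
    (fun x pi => if pi then (1 - x ord0 0 0) * a + x ord0 0 0 * b else 0).

Definition diagonal_profile (t : R) : profile coordination_data :=
  fun=> const_mx t.

(** The cost common to both followers is a square that vanishes on the diagonal, so no deviation can
    lower it. *)
Lemma diagonal_profile_NE (t : R) (pi : leader coordination_data) :
  0 <= t <= 1 -> NE pi (diagonal_profile t).
Proof.
move=> /andP[t0 t1]; split => [i k|i y _].
  rewrite !mxE big_ord1 !mxE.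
  by case: k => -[|[|//]] ? /=; rewrite ?expr0 ?mul1r ?expr1 ?mulN1r ?oppr_le0.
by rewrite /= !mxE subrr expr0n sqr_ge0.
Qed.

Definition coordination_game : stackelberg_game R :=
  @StackelbergGame R coordination_data (fun pi =>
    ex_intro _ (diagonal_profile 1)
      (@diagonal_profile_NE 1 pi (introT andP (conj ler01 (lexx _))))).

(** The risky payoff is affine in the first follower's coordinate, which is a projection followed by
    a matrix entry. *)
Lemma coordination_payoff_continuous (pi : leader coordination_game) :
  continuous ((@payoff R coordination_game)^~ pi
    : profile coordination_game -> R).
Proof.
have cx : continuous (fun x : profile coordination_game => x ord0 0 0).
  move=> x; have px := @proj_continuous 'I_2 (fun=> 'cV[R]_1) ord0 x.
  exact: (continuous_comp px (@coord_continuous R 1 1 0 0 _)).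
case: pi => x; last exact: cst_continuous.
apply: (@continuousD _ _ _ (fun x : profile coordination_game => (1 - x ord0 0 0) * a)
  (fun x : profile coordination_game => x ord0 0 0 * b)).
- apply: continuousM; last exact: cst_continuous.
  by apply: continuousB; [exact: cst_continuous|exact: cx].
- by apply: continuousM; [exact: cx|exact: cst_continuous].
Qed.

Definition coordination_oracle : stochastic_oracle coordination_game :=
  @dirac_oracle R coordination_game (fun=> diagonal_profile 1)
    (fun pi => @diagonal_profile_NE 1 pi (introT andP (conj ler01 (lexx _))))
    coordination_payoff_continuous.

Lemma expected_payoff_coordination (pi : leader coordination_game) :
  expected_payoff coordination_oracle pi = (if pi then b else 0)%:E.
Proof.
rewrite expected_payoff_dirac; case: pi => //=.
by rewrite !mxE subrr mul0r mul1r add0r.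
Qed.

Lemma optimal_payoff_coordination :
  optimal_payoff coordination_oracle = (Num.max b 0)%:E.
Proof.
apply/eqP; rewrite eq_le; apply/andP; split.
  apply: ge_ereal_sup => _ [pi _ <-]; rewrite expected_payoff_coordination.
  by rewrite lee_fin le_max; case: pi; rewrite lexx ?orbT.
rewrite EFin_max ge_max; apply/andP; split; apply: ereal_sup_ubound.
  by exists true => //; rewrite expected_payoff_coordination.
by exists false => //; rewrite expected_payoff_coordination.
Qed.

Lemma payoff_diagonal0 :
  @payoff R coordination_game (diagonal_profile 0) true = a.
Proof. by rewrite /= !mxE subr0 mul1r mul0r addr0. Qed.

(** The equilibrium (0, 0) pays [a]; for [0 < a] this lower bound already separates the supremum
    from the safe value 0. *)
Lemma optimistic_value_risky :
  (a%:E <= @optimistic_value R coordination_game true)%E.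
Proof.
apply: ereal_sup_ubound; exists (diagonal_profile 0).
  by apply: diagonal_profile_NE; rewrite lexx ler01.
by rewrite payoff_diagonal0.
Qed.

(** Dually, (0, 0) bounds the infimum from above, which decides the comparison with 0 when
    [a < 0]. *)
Lemma pessimistic_value_risky :
  (@pessimistic_value R coordination_game true <= a%:E)%E.
Proof.
apply: ereal_inf_lbound; exists (diagonal_profile 0).
  by apply: diagonal_profile_NE; rewrite lexx ler01.
by rewrite payoff_diagonal0.
Qed.

(** Existence of an equilibrium matters here: over an empty set the supremum would be [-oo] and the
    infimum [+oo] instead of 0. *)
Let safe_payoffs :
  [set (@payoff R coordination_game x false)%:E | x in NE (false : leader coordination_game)]
  = [set 0%E].
Proof.
apply/seteqP; split => [_ [x _ <-]//|_ ->].
by have [x NEx] := @NE_nonempty R coordination_game false; exists x.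
Qed.

Lemma optimistic_value_safe :
  @optimistic_value R coordination_game false = 0%E.
Proof. by rewrite /optimistic_value safe_payoffs ereal_sup1. Qed.

Lemma pessimistic_value_safe :
  @pessimistic_value R coordination_game false = 0%E.
Proof. by rewrite /pessimistic_value safe_payoffs ereal_inf1. Qed.

Lemma optimistic_optimal_coordination (pi : leader coordination_game) :
  0 < a -> optimistic_optimal pi <-> pi = true.
Proof.
move=> a0.
have lt_value : (@optimistic_value R coordination_game false <
                 @optimistic_value R coordination_game true)%E.
  by rewrite optimistic_value_safe (lt_le_trans _ optimistic_value_risky).
split=> [|-> [] //]; last exact: ltW.
by case: pi => // /(_ true); rewrite leNgt lt_value.
Qed.

Lemma pessimistic_optimal_coordination (pi : leader coordination_game) :
  a < 0 -> pessimistic_optimal pi <-> pi = false.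
Proof.
move=> a0.
have lt_value : (@pessimistic_value R coordination_game true <
                 @pessimistic_value R coordination_game false)%E.
  by rewrite pessimistic_value_safe (le_lt_trans pessimistic_value_risky).
split=> [|-> [] //]; last exact: ltW.
by case: pi => // /(_ false); rewrite leNgt lt_value.
Qed.

End CoordinationGame.

Theorem theorem1 (R : realType) :
  (forall M : R, 0 < M ->
     exists (G : stackelberg_game R) (O : stochastic_oracle G),
       optimal_payoff O \is a fin_num /\
       (exists pi : leader G, optimistic_optimal pi) /\
       (forall pi_opt : leader G, optimistic_optimal pi_opt ->
          (expected_payoff O pi_opt <= optimal_payoff O - M%:E)%E)) /\
  (forall M : R, 0 < M ->
     exists (G : stackelberg_game R) (O : stochastic_oracle G),
       optimal_payoff O \is a fin_num /\
       (exists pi : leader G, pessimistic_optimal pi) /\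
       (forall pi_pes : leader G, pessimistic_optimal pi_pes ->
          (expected_payoff O pi_pes <= optimal_payoff O - M%:E)%E)).
Proof.
split=> M M0.
  (* The optimum is [max (- M) 0 = 0] and the risky choice earns [- M]: the loss is exactly [M]. *)
  exists (coordination_game 1 (- M)), (coordination_oracle 1 (- M)).
  rewrite optimal_payoff_coordination; split => //.
  split; first by exists true; exact/optimistic_optimal_coordination.
  move=> pi /(optimistic_optimal_coordination _ _ _ ltr01) ->.
  rewrite expected_payoff_coordination -EFinB lee_fin.
  by rewrite max_r ?sub0r// oppr_le0 ltW.
(* The optimum is [max M 0 = M] and the safe choice earns 0: again the loss is exactly [M]. *)
exists (coordination_game (-1) M), (coordination_oracle (-1) M).
rewrite optimal_payoff_coordination; split => //.
split; first by exists false; apply/pessimistic_optimal_coordination => //; exact: ltrN10.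
move=> pi /(pessimistic_optimal_coordination _ _ _ (ltrN10 R)) ->.
rewrite expected_payoff_coordination -EFinB lee_fin.
by rewrite max_l ?subrr// ltW.
Qed.
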